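(* Let $1\le k<n$, $T\ge1$, and let $x_1,\dots,x_T\in\mathbb{R}^n$ with $\|x_t\|\le1$. Let $\mathscr{B}^n_{n-k}=\{W\in\mathbb{R}^{n\times n}:W=W^\top\succeq0,\ \|W\|_2\le\frac1{n-k},\ \mathrm{Tr}(W)=1\}$. Run the following uncentered online adaptive PCA algorithm: start from $W_1\in\mathscr{B}^n_{n-k}$; at each $t$, eigendecompose $W_t=\bar D\,\mathrm{diag}(w_t)\bar D^\top$, write $w_t$ as a convex combination $\sum_jp_jr_j$ of vectors $r_j$ having $n-k$ entries equal to $\frac1{n-k}$ and the rest $0$, sample $r=r_j$ with probability $p_j$, and play the rank-$k$ projection $P_t=I-(n-k)\bar D\,\mathrm{diag}(r)\bar D^\top$ (so the expected compression loss is $(n-k)\mathrm{Tr}(W_tx_tx_t^\top)$); then observe $x_t$ and update $$V_{t+1}=\frac{\exp(\ln W_t-\eta x_tx_t^\top)}{\mathrm{Tr}\exp(\ln W_t-\eta x_tx_t^\top)},\ V_{t+1}=U\mathrm{diag}(v_{t+1})U^\top,\ \widehat W_{t+1}=U\mathrm{diag}\Big(\frac\alpha n+(1-\alpha)v_{t+1}\Big)U^\top,$$ $$W_{t+1}=\operatorname{argmin}_{W\in\mathscr{B}^n_{n-k}}\Delta(W,\widehat W_{t+1}),$$ where $\Delta(P,Q)=\mathrm{Tr}(P\ln P)-\mathrm{Tr}(P\ln Q)$. Suppose $L>0$ satisfies $\min_{Q\in\mathscr{B}^n_{n-k}}\sum_{t=r}^s(n-k)\mathrm{Tr}(Qx_tx_t^\top)\le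 L$ for all $1\le r\le s\le T$, and set $\alpha=\frac1{T(n-k)+1}$, $D=(n-k)\ln(n(1+(n-k)T))+1$, $\eta=\ln(1+\sqrt{2D/L})$. Then $$\mathcal{R}_a:=\max_{[r,s]\subset[1,T]}\Big\{\sum_{t=r}^s\mathbb{E}[\mathrm{Tr}((I-P_t)x_tx_t^\top)]-\min_{U\in\mathcal{S}}\sum_{t=r}^s\mathrm{Tr}((I-U)x_tx_t^\top)\Big\}\le O(\sqrt{2LD}+D),$$ where $\mathcal{S}$ is the set of rank-$k$ orthogonal projection matrices in $\mathbb{R}^{n\times n}$.
   Context: $\ln$ and $\exp$ of symmetric matrices are matrix logarithm/exponential. $O(\cdot)$ hides an absolute constant. *)

(* Defs.v *)
From HB Require Import structures.
From mathcomp Require Import all_boot all_order all_algebra.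
From mathcomp Require Import boolp classical_sets reals sequences exp.
Set Implicit Arguments. Unset Strict Implicit. Unset Printing Implicit Defensive.
Import Order.TTheory GRing.Theory Num.Theory.
Local Open Scope ring_scope.

Section Defs.
Variable R : realType.

Definition mx_sym n (A : 'M[R]_n) : Prop := A^T = A.
Definition mx_psd n (A : 'M[R]_n) : Prop :=
  forall v : 'cV[R]_n, 0 <= (v^T *m A *m v) 0 0.
Definition mx_pd n (A : 'M[R]_n) : Prop :=
  forall v : 'cV[R]_n, v != 0 -> 0 < (v^T *m A *m v) 0 0.

Definition sqnorm n (v : 'cV[R]_n) : R := \sum_i v i 0 ^+ 2.

(* ||A||_2 <= c  (operator 2-norm), for c >= 0 *)
Definition spec_norm_le n (A : 'M[R]_n) (c : R) : Prop :=
  forall v : 'cV[R]_n, sqnorm (A *m v) <= c ^+ 2 * sqnorm v.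

Definition capped_set n k : set 'M[R]_n :=
  [set W | mx_sym W /\ mx_psd W /\ spec_norm_le W ((n - k)%:R)^-1 /\ \tr W = 1].

Definition mxfun n (f : R -> R) (A : 'M[R]_n) : 'M[R]_n :=
  xget 0 [set B | exists (U : 'M[R]_n) (d : 'rV[R]_n),
     U *m U^T = 1%:M /\ A = U *m diag_mx d *m U^T /\
     B = U *m diag_mx (map_mx f d) *m U^T].

Definition mxexp n (A : 'M[R]_n) := mxfun expR A.
Definition mxln n (A : 'M[R]_n) := mxfun (@ln R) A.   (* note: ln 0 = 0 gives 0 ln 0 = 0 *)

Definition relent n (P Q : 'M[R]_n) : R := \tr (P *m mxln P) - \tr (P *m mxln Q).

Definition rankk_proj n k (U : 'M[R]_n) : Prop :=
  U^T = U /\ U *m U = U /\ \rank U = k.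

Definition outer n (x : 'cV[R]_n) : 'M[R]_n := x *m x^T.

Definition subset_vec n k (r : 'rV[R]_n) : Prop :=
  (forall i, r 0 i = 0 \/ r 0 i = ((n - k)%:R)^-1) /\
  #|[set i | r 0 i != 0]| = (n - k)%N.

Definition pca_step n k (alpha eta : R) (x : 'cV[R]_n) (Wt Vn Whn Wn : 'M[R]_n) : Prop :=
  Vn = (\tr (mxexp (mxln Wt - eta *: outer x)))^-1 *: mxexp (mxln Wt - eta *: outer x) /\
  (exists (U : 'M[R]_n) (v : 'rV[R]_n), U *m U^T = 1%:M /\
      Vn = U *m diag_mx v *m U^T /\
      Whn = U *m diag_mx (\row_i (alpha / n%:R + (1 - alpha) * v 0 i)) *m U^T) /\
  capped_set k Wn /\
  (forall W, capped_set k W -> relent Wn Whn <= relent W Whn).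

Definition valid_sampling n k (Wt Dm : 'M[R]_n) (s : seq (R * 'rV[R]_n)) : Prop :=
  Dm *m Dm^T = 1%:M /\
  Wt = Dm *m diag_mx (\sum_(pr <- s) pr.1 *: pr.2) *m Dm^T /\
  (forall pr, pr \in s -> 0 <= pr.1 /\ subset_vec k pr.2) /\
  \sum_(pr <- s) pr.1 = 1.

Definition played_proj n k (Dm : 'M[R]_n) (r : 'rV[R]_n) : 'M[R]_n :=
  1%:M - (n - k)%:R *: (Dm *m diag_mx r *m Dm^T).

Definition exp_loss n k (Dm : 'M[R]_n) (s : seq (R * 'rV[R]_n)) (x : 'cV[R]_n) : R :=
  \sum_(pr <- s) pr.1 * \tr ((1%:M - played_proj k Dm pr.2) *m outer x).

End Defs.
Arguments capped_set {R} n k _.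

(* Main.v *)
(* The matrix exponential is handled without the Golden-Thompson inequality.  Since
   p ln(p/q) - p + q >= (sqrt p - sqrt q)^2, Klein's argument gives, for P and W of equal
   trace, relent P W >= || sqrt P - sqrt W ||^2 in Hilbert-Schmidt norm.  As
   Tr(P x x^T) = |(sqrt P) x|^2, this yields, for |x| <= 1,
     relent P W + eta Tr(P x x^T) >= eta / (1 + eta) Tr(W x x^T),
   which, applied to P = V_(t+1), bounds the log-partition function of the update.  Hence
   Tr(Q ln W_t) increases at each step by at least
     eta / (1 + eta) Tr(W_t x_t x_t^T) - eta Tr(Q x_t x_t^T) + ln(1 - alpha);
   mixing costs ln(1 - alpha), and projecting onto the capped set costs nothing.
   On an interval [r, s] this is summed over r < t < s only: the losses of rounds r and s are at
   most 1 <= D each, so that neither the arbitrary W_1 nor a missing update at time T matters.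
   A projection whose loss exceeds L is replaced by the comparator given by the
   assumption on L. *)
Require Import Defs.
From HB Require Import structures.
From mathcomp Require Import all_boot all_order all_algebra.
From mathcomp Require Import boolp classical_sets reals sequences exp.
From mathcomp Require Import topology normedtype ring lra.
From mathcomp Require spectral complex.
Import Order.TTheory GRing.Theory Num.Theory.
Local Open Scope ring_scope.

Set Implicit Arguments. Unset Strict Implicit. Unset Printing Implicit Defensive.

(** * Spectral theorem for real symmetric matrices *)

Section SpectralTheorem.
Import complex spectral.
Variable R : realType.

(** Over the complex numbers [A] is Hermitian, so it has an eigenvalue, and that eigenvalue is real.
    Being a root of the characteristic polynomial descends to [R], which yields a real row
    eigenvector, transposed by symmetry. *)
Lemma symmetric_eigenvector n (A : 'M[R]_n.+1) : A^T = A ->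
  exists (a : R) (v : 'cV[R]_n.+1), v != 0 /\ A *m v = a *: v.
Proof.
move=> symA; pose f := real_complex R.
pose B : 'M[R[i]]_n.+1 := map_mx f A.
have hB : B \is hermsymmx.
  apply: realsym_hermsym.
    by apply/is_hermitianmxP; rewrite expr0 scale1r map_mx_id // /B map_trmx symA.
  by apply/mxOverP=> i j; rewrite mxE; apply/complex_realP; exists (A i j).
have /mxOverP/(_ 0 0)/complex_realP[a ea] := hermitian_spectral_diag_real hB.
have /hermitian_normalmx/orthomx_spectralP := hB.
set P := spectralmx B; set d := spectral_diag B => eB.
have uP : P \in unitmx by exact: spectral_unit.
have : eigenvalue B (f a).
  apply/eigenvalueP; exists (row 0 P); last first.
    by apply/eqP => /(congr1 (mulmx^~ (invmx P)));
       rewrite mul0mx -row_mul mulmxV // => /rowP/(_ 0); rewrite !mxE eqxx => /eqP;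
       rewrite oner_eq0.
  rewrite -row_mul eB !mulmxA mulmxV // mul1mx row_mul; apply/rowP => j.
  rewrite mxE (bigD1 0) //= big1 ?addr0; last first.
    by move=> i i0; rewrite !mxE eq_sym (negPf i0) mulr0n mul0r.
  by rewrite !mxE eqxx mulr1n ea.
rewrite eigenvalue_root_char /B -map_char_poly fmorph_root -eigenvalue_root_char.
case/eigenvalueP => v vA v0; exists a, v^T; split; first by rewrite trmx_eq0.
by rewrite -[A in LHS]symA -trmx_mul vA linearZ.
Qed.

(** [H] is the Householder reflection along [v - e], which exchanges the unit vectors [e] and [v];
    when they coincide the identity serves. *)
Lemma orthogonal_completion n (v : 'cV[R]_(1 + n)) : v^T *m v = 1%:M ->
  exists2 H : 'M[R]_(1 + n), H *m H^T = 1%:M & H *m delta_mx 0 0 = v.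
Proof.
move=> v1; pose e : 'cV[R]_(1 + n) := delta_mx 0 0.
have [->|ve] := eqVneq v e; first by exists 1%:M; rewrite ?trmx1 ?mul1mx.
have [w wE] : {w | w = v - e} by exists (v - e).
pose s := (w^T *m w) 0 0.
have E : w^T *m w = s%:M by apply/matrixP => i j; rewrite !ord1 [RHS]mxE mulr1n.
have s0 : s != 0.
  apply: contra ve => /eqP; rewrite /s mxE => /eqP.
  rewrite psumr_eq0 => [/allP z|i _]; last by rewrite mxE -expr2 sqr_ge0.
  rewrite -subr_eq0; apply/eqP/colP => i; move: (z i); rewrite mem_index_enum => /(_ isT).
  by rewrite mxE -expr2 sqrf_eq0 -wE => /eqP ->; rewrite mxE.
(* Both vectors have norm 1, so |v - e|^2 = 2 (1 - <v, e>). *)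
have we : w^T *m e = (- (s / 2))%:M.
  have e1 : e^T *m e = 1%:M.
    rewrite /e trmx_delta mul_delta_mx; apply/matrixP=> i j.
    by rewrite !ord1 !mxE !eqxx.
  have ve' : v^T *m e = e^T *m v.
    by rewrite -[LHS]trmxK trmx_mul trmxK; apply/matrixP => i j; rewrite !ord1 mxE.
  have sE : s%:M = 2 *: (1%:M - v^T *m e) :> 'M[R]_1.
    rewrite -E wE [(v - e)^T]linearB mulmxBl !mulmxBr v1 e1 ve' scaler_nat mulr2n.
    by rewrite opprB addrACA; congr (_ + _); rewrite addrC.
  rewrite wE [(v - e)^T]linearB mulmxBl e1.
  apply: (scalerI (a := - 2)); first by rewrite oppr_eq0 pnatr_eq0.
  rewrite [RHS]scale_scalar_mx scaleNr -scalerN opprB -sE.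
  by congr (_%:M); field.
exists (1%:M - (2 / s) *: (w *m w^T)).
  rewrite [(_ - _)^T]linearB /= [trmx (_ *: _)]linearZ /= trmx_mul trmxK trmx1.
  rewrite mulmxBl mul1mx mulmxBr mulmx1 -scalemxAl -scalemxAr.
  rewrite mulmxA -(mulmxA w) E mul_mx_scalar -scalemxAl !scalerA.
  rewrite -addrA -[RHS]addr0 -opprD; congr (_ + _).
  rewrite -scalerBl -scalerDl -scaleNr -[RHS](scale0r (w *m w^T)); congr (_ *: _).
  by field.
rewrite mulmxBl mul1mx -scalemxAl -mulmxA -/e we mul_mx_scalar scalerA.
rewrite (_ : _ * _ = -1); last by field.
by rewrite scaleN1r opprK wE addrC subrK.
Qed.

(** Deflation: in an orthonormal basis starting with a unit eigenvector, [A] is block diagonal by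
    symmetry, and the induction treats the lower block. *)
Theorem symmetric_spectral n (A : 'M[R]_n) : A^T = A ->
  exists (U : 'M[R]_n) (d : 'rV[R]_n),
    U *m U^T = 1%:M /\ A = U *m diag_mx d *m U^T.
Proof.
elim: n A => [|n IH] A symA.
  by exists 1%:M, 0; split; apply/matrixP => -[].
have [a [v [v0 Av]]] := symmetric_eigenvector symA.
pose s := (v^T *m v) 0 0.
have s0 : 0 < s.
  rewrite lt_neqAle; apply/andP; split; last first.
    by rewrite /s mxE sumr_ge0 // => i _; rewrite mxE -expr2 sqr_ge0.
  apply: contra v0; rewrite eq_sym /s mxE.
  rewrite psumr_eq0 => [/allP z|i _]; last by rewrite mxE -expr2 sqr_ge0.
  apply/eqP/colP => i; move: (z i); rewrite mem_index_enum => /(_ isT).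
  by rewrite mxE -expr2 sqrf_eq0 => /eqP ->; rewrite mxE.
pose u := (Num.sqrt s)^-1 *: v.
have u1 : u^T *m u = 1%:M.
  rewrite /u [trmx (_ *: _)]linearZ /= -scalemxAl -scalemxAr scalerA -invfM -expr2.
  rewrite sqr_sqrtr ?ltW //; apply/matrixP => i j; rewrite !ord1 mxE -/s mulVf ?gt_eqF //.
  by rewrite mxE.
have Au : A *m u = a *: u by rewrite /u -scalemxAr Av !scalerA mulrC.
have [H HH He] := @orthogonal_completion n u u1.
have HH' := mulmx1C HH.
have [B defB] : {B : 'M[R]_(1 + n) | B = H^T *m A *m H} by exists (H^T *m A *m H).
have symB : B^T = B by rewrite defB !trmx_mul trmxK symA mulmxA.
have B0 : B *m delta_mx 0 0 = a *: (delta_mx 0 0 : 'cV[R]_(1 + n)).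
  by rewrite defB -!mulmxA He Au -scalemxAr -{1}He mulmxA HH' mul1mx.
have BE : B = block_mx a%:M 0 0 (drsubmx B).
  have c i : B i ord0 = a * (i == ord0)%:R.
    have := congr1 (fun M : 'cV[R]_(1 + n) => M i 0) B0; rewrite -colE !mxE => ->.
    by rewrite andbT.
  have l0 : lshift n ord0 = ord0 :> 'I_(1 + n) by apply/val_inj.
  rewrite -[LHS]submxK; congr block_mx; apply/matrixP => i j.
  - rewrite !ord1 !mxE mulr1n l0.
    by rewrite c eqxx mulr1.
  - rewrite ord1 !mxE l0.
    by rewrite -symB mxE c (_ : _ == _ = false) ?mulr0.
  - rewrite ord1 !mxE l0.
    by rewrite c (_ : _ == _ = false) ?mulr0.
have [|U [d [UU dE]]] := IH (drsubmx B); first by rewrite trmx_drsub symB.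
have e : B = block_mx 1%:M 0 0 U *m diag_mx (row_mx a%:M d) *m (block_mx 1%:M 0 0 U)^T.
  rewrite {1}BE {1}dE tr_block_mx !trmx0 trmx1 diag_mx_row !mulmx_block.
  rewrite !(mulmx0, mul0mx, mulmx1, mul1mx, addr0, add0r).
  by congr block_mx; apply/matrixP => i j; rewrite !ord1 !mxE !eqxx !mulr1n.
pose K : 'M[R]_(1 + n) := block_mx 1%:M 0 0 U.
have KK : K *m K^T = 1%:M.
  rewrite /K tr_block_mx !trmx0 trmx1 mulmx_block.
  by rewrite !(mulmx0, mul0mx, mulmx1, mul1mx, addr0, add0r) UU -scalar_mx_block.
exists (H *m K), (row_mx a%:M d); split.
  by rewrite trmx_mul mulmxA -(mulmxA H) KK mulmx1.
rewrite trmx_mul !mulmxA -(mulmxA H) -(mulmxA H) -/K -e defB !mulmxA HH mul1mx.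
by rewrite -mulmxA HH mulmx1.
Qed.

End SpectralTheorem.

(** * Functional calculus in an orthonormal eigenbasis *)

Section SpectralCalculus.
Variable R : realType.
Implicit Types (n : nat) (f g : R -> R).

Definition odiag n (U : 'M[R]_n) (d : 'rV[R]_n) := U *m diag_mx d *m U^T.

Lemma odiag_trmx n (U : 'M[R]_n) d : (odiag U d)^T = odiag U d.
Proof. by rewrite /odiag !trmx_mul trmxK tr_diag_mx mulmxA. Qed.

Lemma odiagD n (U : 'M[R]_n) d e : odiag U (d + e) = odiag U d + odiag U e.
Proof. by rewrite /odiag linearD mulmxDr mulmxDl. Qed.

Lemma odiagZ n (U : 'M[R]_n) a d : odiag U (a *: d) = a *: odiag U d.
Proof. by rewrite /odiag linearZ -scalemxAr -scalemxAl. Qed.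

Lemma odiag_const n (U : 'M[R]_n) a : U *m U^T = 1%:M ->
  odiag U (const_mx a) = a%:M.
Proof. by move=> UU; rewrite /odiag diag_const_mx mul_mx_scalar -scalemxAl UU scalemx1. Qed.

Lemma mxtrace_odiag n (U : 'M[R]_n) d : U *m U^T = 1%:M ->
  \tr (odiag U d) = \sum_i d 0 i.
Proof. by move=> UU; rewrite /odiag mxtrace_mulC mulmxA (mulmx1C UU) mul1mx mxtrace_diag. Qed.

Lemma orthogonal_row_sqr n (M : 'M[R]_n) i : M *m M^T = 1%:M ->
  \sum_j M i j ^+ 2 = 1.
Proof.
move=> /matrixP/(_ i i); rewrite !mxE eqxx => h; apply: etrans h.
by apply: eq_bigr => j _; rewrite mxE.
Qed.

Lemma orthogonal_col_sqr n (M : 'M[R]_n) j : M *m M^T = 1%:M ->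
  \sum_i M i j ^+ 2 = 1.
Proof.
move=> /mulmx1C MM; rewrite -[RHS](@orthogonal_row_sqr n M^T j) ?trmxK //.
by apply: eq_bigr => i _; rewrite mxE.
Qed.

Lemma mulmx_col m n p (A : 'M[R]_(m, n)) (B : 'M[R]_(n, p)) i :
  A *m col i B = col i (A *m B).
Proof. by rewrite !colE mulmxA. Qed.

Lemma mulmx_diag_row m n (A : 'M[R]_(m, n)) d i j :
  (A *m diag_mx d) i j = A i j * d 0 j.
Proof. by rewrite mul_mx_diag mxE. Qed.

(** With orthogonal [U] and [V] the weights are the squared overlaps of two eigenbases, so that
    trace inequalities reduce to scalar ones between pairs of eigenvalues. *)
Lemma mxtrace_odiagM n (U V : 'M[R]_n) p q :
  \tr (odiag U p *m odiag V q) =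
  \sum_i \sum_j (U^T *m V) i j ^+ 2 * (p 0 i * q 0 j).
Proof.
set M := U^T *m V.
have -> : \tr (odiag U p *m odiag V q) = \tr (diag_mx p *m M *m diag_mx q *m M^T).
  by rewrite /odiag -!mulmxA mxtrace_mulC /M trmx_mul trmxK !mulmxA.
apply: eq_bigr => i _; rewrite mxE; apply: eq_bigr => j _.
by rewrite mulmx_diag_row mul_diag_mx [in LHS]mxE [M^T _ _]mxE; ring.
Qed.

(** This makes [mxfun] independent of the diagonalisation: [U^T *m V] intertwines the two diagonal
    matrices, so each of its entries either vanishes or links equal eigenvalues, on which [f]
    agrees. *)
Lemma odiag_fun n f (U V : 'M[R]_n) p q :
  U *m U^T = 1%:M -> V *m V^T = 1%:M -> odiag U p = odiag V q ->
  odiag U (map_mx f p) = odiag V (map_mx f q).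
Proof.
move=> UU VV E; have UU' := mulmx1C UU; have VV' := mulmx1C VV.
have eqM g : diag_mx (map_mx g p) *m (U^T *m V) = (U^T *m V) *m diag_mx (map_mx g q) ->
             odiag U (map_mx g p) = odiag V (map_mx g q).
  move=> h; rewrite /odiag -[LHS]mulmx1 -VV mulmxA -(mulmxA _ U^T V) -(mulmxA U) h.
  by rewrite !mulmxA UU mul1mx.
apply: eqM; apply/matrixP => i j.
have : diag_mx p *m (U^T *m V) = (U^T *m V) *m diag_mx q.
  have := congr1 (fun X => U^T *m X *m V) E; rewrite /odiag !mulmxA UU' mul1mx.
  by rewrite -!mulmxA VV' mulmx1.
move=> /matrixP/(_ i j); rewrite !mul_diag_mx !mul_mx_diag !mxE.
set m := \sum_(_ | _) _ => h.
have [->|m0] := eqVneq m 0; first by rewrite mulr0 mul0r.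
by rewrite mulrC; congr (_ * f _); apply: (mulfI m0); rewrite mulrC.
Qed.

Lemma mxfun_odiag n f (U : 'M[R]_n) d : U *m U^T = 1%:M ->
  mxfun f (odiag U d) = odiag U (map_mx f d).
Proof.
move=> UU; apply: xget_unique; first by exists U, d.
move=> B [V [e [VV [E ->]]]]; symmetry; exact: odiag_fun.
Qed.

Lemma symmetric_odiag n (A : 'M[R]_n) : A^T = A ->
  exists U d, U *m U^T = 1%:M /\ A = odiag U d.
Proof. exact: symmetric_spectral. Qed.

Lemma mxfun_trmx n f (A : 'M[R]_n) : A^T = A -> (mxfun f A)^T = mxfun f A.
Proof.
by move=> /symmetric_odiag[U [d [UU ->]]]; rewrite mxfun_odiag // odiag_trmx.
Qed.

Lemma sqnormE n (v : 'cV[R]_n) : sqnorm v = (v^T *m v) 0 0.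
Proof. by rewrite mxE; apply: eq_bigr => i _; rewrite mxE expr2. Qed.

Lemma sqnorm_ge0 n (v : 'cV[R]_n) : 0 <= sqnorm v.
Proof. by apply: sumr_ge0 => i _; rewrite sqr_ge0. Qed.

Lemma odiag_form n (U : 'M[R]_n) d (v : 'cV[R]_n) :
  (v^T *m odiag U d *m v) 0 0 = \sum_i d 0 i * (U^T *m v) i 0 ^+ 2.
Proof.
rewrite /odiag !mulmxA -(mulmxA _ U^T) -[v^T *m U]trmxK trmx_mul trmxK mxE.
apply: eq_bigr => i _; rewrite mul_mx_diag !mxE; ring.
Qed.

Lemma odiag_eigen n (U : 'M[R]_n) d i : U *m U^T = 1%:M ->
  ((col i U)^T *m odiag U d *m col i U) 0 0 = d 0 i.
Proof.
move=> UU; rewrite odiag_form mulmx_col (mulmx1C UU) (bigD1 i) //=.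
rewrite big1 ?addr0 => [|j ji]; first by rewrite !mxE eqxx expr1n mulr1.
by rewrite !mxE (negPf ji) expr0n mulr0.
Qed.

Lemma orthogonal_col_neq0 n (U : 'M[R]_n) i : U *m U^T = 1%:M -> col i U != 0.
Proof.
move=> UU; apply/eqP => /(congr1 (fun v : 'cV[R]_n => (U^T *m v) i 0)).
by rewrite mulmx_col (mulmx1C UU) mulmx0 !mxE eqxx => /eqP; rewrite oner_eq0.
Qed.

Lemma odiag_psd n (U : 'M[R]_n) (d : 'rV[R]_n) : (forall i, 0 <= d 0 i) -> mx_psd (odiag U d).
Proof.
by move=> d0 v; rewrite odiag_form sumr_ge0 // => i _; rewrite mulr_ge0 // sqr_ge0.
Qed.

Lemma odiag_pd n (U : 'M[R]_n) (d : 'rV[R]_n) : U *m U^T = 1%:M -> (forall i, 0 < d 0 i) ->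
  mx_pd (odiag U d).
Proof.
move=> UU d0 v v0; rewrite lt_neqAle odiag_psd ?andbT; last by move=> i; exact: ltW.
apply: contra v0; rewrite eq_sym odiag_form psumr_eq0 => [/allP z|i _]; last first.
  by rewrite mulr_ge0 ?sqr_ge0 // ltW.
apply/eqP; rewrite -[v]mul1mx -UU -mulmxA; apply: (etrans _ (mulmx0 _ U)).
congr (_ *m _); apply/colP => i; have := z i; rewrite mem_index_enum => /(_ isT).
by rewrite /= mulf_eq0 gt_eqF //= sqrf_eq0 => /eqP ->; rewrite mxE.
Qed.

Lemma psd_odiag n (U : 'M[R]_n) (d : 'rV[R]_n) : U *m U^T = 1%:M -> mx_psd (odiag U d) ->
  forall i, 0 <= d 0 i.
Proof. by move=> UU h i; rewrite -(odiag_eigen d i UU). Qed.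

Lemma pd_odiag n (U : 'M[R]_n) (d : 'rV[R]_n) : U *m U^T = 1%:M -> mx_pd (odiag U d) ->
  forall i, 0 < d 0 i.
Proof.
by move=> UU h i; rewrite -(odiag_eigen d i UU); apply: h; exact: orthogonal_col_neq0.
Qed.

Lemma mxtrace_outer n (A : 'M[R]_n) x : \tr (A *m outer x) = (x^T *m A *m x) 0 0.
Proof.
by rewrite /outer mulmxA mxtrace_mulC mulmxA /mxtrace big_ord1.
Qed.

Lemma mxtrace_mul_odiag n (Q U : 'M[R]_n) d :
  \tr (Q *m odiag U d) = \sum_i ((col i U)^T *m Q *m col i U) 0 0 * d 0 i.
Proof.
rewrite /odiag !mulmxA mxtrace_mulC !mulmxA; apply: eq_bigr => i _.
rewrite mul_mx_diag mxE; congr (_ * _); rewrite !mxE.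
by apply: eq_bigr => j _; rewrite tr_col -row_mul !mxE.
Qed.

Lemma mxtrace_form n (Q U : 'M[R]_n) : U *m U^T = 1%:M ->
  \tr Q = \sum_i ((col i U)^T *m Q *m col i U) 0 0.
Proof.
move=> UU; rewrite -[LHS](congr1 mxtrace (mulmx1 Q)) -(odiag_const 1 UU) mxtrace_mul_odiag.
by apply: eq_bigr => i _; rewrite [const_mx _ _ _]mxE mulr1.
Qed.

Lemma mxtrace_psd_le n (Q U : 'M[R]_n) (d e : 'rV[R]_n) : mx_psd Q -> (forall i, d 0 i <= e 0 i) ->
  \tr (Q *m odiag U d) <= \tr (Q *m odiag U e).
Proof.
by move=> Q0 de; rewrite !mxtrace_mul_odiag ler_sum // => i _; rewrite ler_wpM2l.
Qed.

End SpectralCalculus.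

(** * Relative entropy bounded below through matrix square roots *)

Section Klein.
Variable R : realType.
Implicit Types (n : nat).

(** With a = sqrt p and b = sqrt q this is 2 a^2 times the inequality ln (b / a) <= b / a - 1. *)
Lemma ln_gap (p q : R) : 0 <= p -> 0 < q ->
  (Num.sqrt p - Num.sqrt q) ^+ 2 <= p * (ln p - ln q) - p + q.
Proof.
move=> p0 q0; have [-> |pN0] := eqVneq p 0.
  by rewrite sqrtr0 mul0r sub0r sqrrN (sqr_sqrtr (ltW q0)) subr0 add0r.
have {pN0}p0 : 0 < p by rewrite lt_neqAle eq_sym pN0.
have a0 : 0 < Num.sqrt p by rewrite sqrtr_gt0.
have b0 : 0 < Num.sqrt q by rewrite sqrtr_gt0.
move: (Num.sqrt p) (Num.sqrt q) (sqr_sqrtr (ltW p0)) (sqr_sqrtr (ltW q0)) a0 b0.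
move=> a b <- <- {p p0 q q0} a0 b0.
rewrite !lnXn //.
have h : ln b - ln a <= b / a - 1.
  rewrite -ln_div ?posrE // -{1}[b / a](subrK 1) addrC le_ln1Dx //.
  by have := divr_gt0 b0 a0; lra.
have := ler_wpM2l (sqr_ge0 a) h.
have -> : a ^+ 2 * (b / a - 1) = a * b - a ^+ 2 by field; rewrite gt_eqF.
rewrite !mulr2n; lra.
Qed.

Lemma cauchy_schwarz_sum n (a x : 'I_n -> R) :
  (\sum_i a i * x i) ^+ 2 <= (\sum_i a i ^+ 2) * (\sum_i x i ^+ 2).
Proof.
set S := \sum_i _ * _; set A := \sum_i _; set X := \sum_i _.
have X0 : 0 <= X by apply: sumr_ge0 => i _; rewrite sqr_ge0.
have [XE|XN0] := eqVneq X 0.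
  rewrite XE mulr0 /S big1 ?expr0n // => i _.
  move/eqP: XE; rewrite psumr_eq0 => [/allP/(_ i)|j _]; last by rewrite sqr_ge0.
  by rewrite mem_index_enum sqrf_eq0 => /(_ isT)/eqP ->; rewrite mulr0.
have Xp : 0 < X by rewrite lt_neqAle eq_sym XN0.
have : 0 <= \sum_i (X * a i - S * x i) ^+ 2.
  by apply: sumr_ge0 => i _; rewrite sqr_ge0.
have E c d : \sum_i (c * a i - d * x i) ^+ 2 = c ^+ 2 * A - 2 * c * d * S + d ^+ 2 * X.
  rewrite /A /S /X !mulr_sumr -sumrB -big_split /=.
  by apply: eq_bigr => i _; ring.
rewrite E (_ : _ + _ = X * (A * X - S ^+ 2)); last ring.
by rewrite pmulr_rge0 // subr_ge0.
Qed.

(** The trace is the squared Hilbert-Schmidt norm, which dominates the operator norm by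
    Cauchy-Schwarz on each row. *)
Lemma sqnorm_mulmx_le n (A : 'M[R]_n) x :
  sqnorm (A *m x) <= \tr (A^T *m A) * sqnorm x.
Proof.
have -> : \tr (A^T *m A) = \sum_i \sum_j A i j ^+ 2.
  rewrite /mxtrace exchange_big /=; apply: eq_bigr => j _; rewrite mxE.
  by apply: eq_bigr => i _; rewrite mxE expr2.
rewrite mulr_suml; apply: ler_sum => i _; rewrite mxE.
exact: cauchy_schwarz_sum.
Qed.

Lemma sqnorm_le0 n (v : 'cV[R]_n) : sqnorm v <= 0 -> v = 0.
Proof.
move=> v0; have /eqP : sqnorm v = 0 by apply/eqP; rewrite eq_le v0 sqnorm_ge0.
rewrite psumr_eq0 => [/allP z|i _]; last by rewrite sqr_ge0.
apply/colP => i; have := z i; rewrite mem_index_enum sqrf_eq0 => /(_ isT)/eqP ->.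
by rewrite mxE.
Qed.

Lemma mxtrace_gram_le0 n (A : 'M[R]_n) : \tr (A^T *m A) <= 0 -> A = 0.
Proof.
move=> A0; apply/matrixP => i j.
have /colP/(_ i) : A *m (delta_mx j 0 : 'cV[R]_n) = 0.
  apply: sqnorm_le0; apply: le_trans (sqnorm_mulmx_le _ _) _.
  by rewrite mulr_le0_ge0 // sqnorm_ge0.
by rewrite -colE !mxE.
Qed.

Definition mxsqrt n (A : 'M[R]_n) := mxfun (@Num.sqrt R) A.

Lemma odiagM n (U : 'M[R]_n) d e : U *m U^T = 1%:M ->
  odiag U d *m odiag U e = odiag U (\row_i (d 0 i * e 0 i)).
Proof.
move=> UU; rewrite /odiag !mulmxA -(mulmxA _ U^T U) (mulmx1C UU) mulmx1.
rewrite -(mulmxA U) mulmx_diag; congr (_ *m diag_mx _ *m _).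
Qed.

Lemma mxsqrtK n (A : 'M[R]_n) : mx_sym A -> mx_psd A -> mxsqrt A *m mxsqrt A = A.
Proof.
move=> /symmetric_odiag[U [d [UU ->]]] d0; rewrite /mxsqrt mxfun_odiag // odiagM //.
congr odiag; apply/rowP => i; rewrite !mxE -expr2 sqr_sqrtr //.
exact: psd_odiag UU d0 i.
Qed.

Lemma mx_pd_psd n (A : 'M[R]_n) : mx_pd A -> mx_psd A.
Proof.
move=> A0 v; have [->|/A0/ltW//] := eqVneq v 0; by rewrite mulmx0 mxE.
Qed.

(* Klein's inequality, sharpened by [ln_gap] in place of convexity. *)
Lemma relent_ge_sqrt n (P W : 'M[R]_n) : mx_sym P -> mx_psd P -> mx_sym W -> mx_pd W ->
  let A := mxsqrt P - mxsqrt W in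
  \tr (A^T *m A) <= relent P W - \tr P + \tr W.
Proof.
move=> sP + sW.
have [U [p [UU ->]]] := symmetric_odiag sP.
have [V [q [VV ->]]] := symmetric_odiag sW.
move=> P0 W0; have p0 := psd_odiag UU P0; have q0 := pd_odiag VV W0.
rewrite /mxsqrt /relent /mxln !mxfun_odiag //.
rewrite [(_ - _)^T]linearB /= !odiag_trmx mulmxBl !mulmxBr.
rewrite !linearB /= [\tr (odiag V _ *m odiag U _)]mxtrace_mulC !odiagM //.
pose T a b := \tr (odiag U a *m odiag V b).
(* Inserting the identity puts single traces on the same overlap weights as the mixed ones, so
   [ln_gap] applies termwise. *)
have TU a : \tr (odiag U a) = T a (const_mx 1) by rewrite /T odiag_const // mulmx1.
have TV b : \tr (odiag V b) = T (const_mx 1) b by rewrite /T odiag_const // mul1mx.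
rewrite !TU !TV /T !mxtrace_odiagM !pair_big /= -!(sumrB, big_split) /=.
apply: ler_sum => -[i j] _ /=; rewrite !mxE.
rewrite -!(mulrBr, mulrDr) ler_wpM2l ?sqr_ge0 //.
have := ln_gap (p0 i) (q0 j); lra.
Qed.

Lemma relent_ge0 n (P W : 'M[R]_n) : mx_sym P -> mx_psd P -> mx_sym W -> mx_pd W ->
  \tr P = \tr W -> 0 <= relent P W.
Proof.
move=> sP P0 sW W0 e; have := relent_ge_sqrt sP P0 sW W0; rewrite e /=.
rewrite subrK; apply: le_trans.
by apply: sumr_ge0 => i _; rewrite mxE sumr_ge0 // => j _; rewrite mxE -expr2 sqr_ge0.
Qed.

(** Equality case: the Hilbert-Schmidt gap forces the square roots to agree, and squaring them gives
    the matrices back. *)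
Lemma relent_le0_eq n (P W : 'M[R]_n) : mx_sym P -> mx_psd P -> mx_sym W -> mx_pd W ->
  \tr P = \tr W -> relent P W <= 0 -> P = W.
Proof.
move=> sP P0 sW W0 e h; have := relent_ge_sqrt sP P0 sW W0.
rewrite e subrK => /le_trans/(_ h)/mxtrace_gram_le0/eqP; rewrite subr_eq0 => /eqP E.
by rewrite -(mxsqrtK sP P0) E mxsqrtK //; exact: mx_pd_psd.
Qed.

(** The left side is the minimum of the right side over [z], attained at y / (1 + eta); completing
    the square shows it. *)
Lemma quadratic_tradeoff (eta y z : R) : 0 <= eta ->
  eta / (1 + eta) * y ^+ 2 <= (z - y) ^+ 2 + eta * z ^+ 2.
Proof.
move=> e0; have e1 : 0 < 1 + eta by lra.
rewrite -subr_ge0.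
have -> : (z - y) ^+ 2 + eta * z ^+ 2 - eta / (1 + eta) * y ^+ 2 =
  (y - (1 + eta) * z) ^+ 2 / (1 + eta) by field; rewrite gt_eqF.
by rewrite divr_ge0 ?sqr_ge0 ?ltW.
Qed.

Lemma relent_tradeoff n (P W : 'M[R]_n) (x : 'cV[R]_n) (eta : R) :
  mx_sym P -> mx_psd P -> mx_sym W -> mx_pd W -> \tr P = \tr W ->
  sqnorm x <= 1 -> 0 <= eta ->
  eta / (1 + eta) * \tr (W *m outer x) <= relent P W + eta * \tr (P *m outer x).
Proof.
move=> sP P0 sW W0 e x1 e0.
have E B : mx_sym B -> mx_psd B -> \tr (B *m outer x) = sqnorm (mxsqrt B *m x).
  move=> sB B0; rewrite mxtrace_outer -{1}(mxsqrtK sB B0) sqnormE trmx_mul.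
  by rewrite mxfun_trmx // !mulmxA.
rewrite !E //; last exact: mx_pd_psd.
have := relent_ge_sqrt sP P0 sW W0; rewrite e subrK /= => h.
have g : sqnorm (mxsqrt P *m x - mxsqrt W *m x) <= relent P W.
  rewrite -mulmxBl; apply: le_trans (sqnorm_mulmx_le _ _) _; apply: le_trans h.
  rewrite ler_piMr //.
  by apply: sumr_ge0 => i _; rewrite mxE sumr_ge0 // => j _; rewrite mxE -expr2 sqr_ge0.
apply: le_trans (lerD g (lexx (eta * sqnorm (mxsqrt P *m x)))).
rewrite /sqnorm !mulr_sumr -big_split /=; apply: ler_sum => i _.
have -> : (mxsqrt P *m x - mxsqrt W *m x) i 0 = (mxsqrt P *m x) i 0 - (mxsqrt W *m x) i 0.
  by rewrite !mxE.
exact: quadratic_tradeoff.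
Qed.

End Klein.

(** * The capped set, its entropic projection, and the progress of one update *)

Section CappedProjection.
Import numFieldNormedType.Exports.
Local Open Scope classical_set_scope.
Variable R : realType.
Implicit Types (n k : nat).

Lemma sqnorm_orthogonal n (U : 'M[R]_n) x : U^T *m U = 1%:M ->
  sqnorm (U *m x) = sqnorm x.
Proof.
by move=> UU; rewrite !sqnormE trmx_mul mulmxA -(mulmxA _ U^T) UU mulmx1.
Qed.

Lemma capped_odiag n k (U : 'M[R]_n) (q : 'rV[R]_n) : U *m U^T = 1%:M ->
  (forall i, 0 <= q 0 i <= (n - k)%:R^-1) -> \sum_i q 0 i = 1 ->
  capped_set n k (odiag U q).
Proof.
move=> UU qc q1; split; first exact: odiag_trmx.
split; first by apply: odiag_psd => i; case/andP: (qc i).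
split; last by rewrite mxtrace_odiag.
move=> x; rewrite /odiag -!mulmxA sqnorm_orthogonal ?(mulmx1C UU) //.
rewrite -[X in _ * X](@sqnorm_orthogonal n U^T) ?trmxK //.
rewrite /sqnorm mulr_sumr; apply: ler_sum => i _.
rewrite mul_diag_mx mxE exprMn ler_wpM2r ?sqr_ge0 //.
have /andP[q0 qle] := qc i.
by rewrite ler_pXn2r // nnegrE // (le_trans q0).
Qed.

(** Expand |c x - W x|^2 >= 0 and bound |W x|^2 by c^2 |x|^2, where c = 1 / (n - k). *)
Lemma capped_form_le n k (W : 'M[R]_n) x : (k < n)%N -> capped_set n k W ->
  (x^T *m W *m x) 0 0 <= (n - k)%:R^-1 * sqnorm x.
Proof.
move=> kn [_ [_ [/(_ x) h _]]]; set c := (n - k)%:R^-1 in h *.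
have c0 : 0 < c by rewrite invr_gt0 ltr0n subn_gt0.
have := sqnorm_ge0 (c *: x - W *m x).
have -> : sqnorm (c *: x - W *m x) =
  c ^+ 2 * sqnorm x - 2 * c * (x^T *m W *m x) 0 0 + sqnorm (W *m x).
  rewrite -mulmxA [(x^T *m _) 0 0]mxE /sqnorm !mulr_sumr -sumrB -big_split /=.
  by apply: eq_bigr => i _; rewrite [(_ - _ : 'cV_n) i 0]mxE !mxE; ring.
move=> h'; rewrite -(ler_pM2l c0); move: h h'.
move: (_ 0 0) (sqnorm x) (sqnorm (W *m x)) => a b d; rewrite !mulrA -expr2; lra.
Qed.

(** Intermediate value theorem: the sum is continuous in [c], is 0 at 0, and reaches n / (n - k) >=
    1 once every term is capped. *)
Lemma capped_scaling n k (w : 'rV[R]_n) : (k < n)%N -> (forall i, 0 < w 0 i) ->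
  exists2 c : R, 0 < c & \sum_i Num.min (c * w 0 i) (n - k)%:R^-1 = 1.
Proof.
move=> kn w0; set m := (n - k)%:R^-1.
have m0 : 0 < m by rewrite invr_gt0 ltr0n subn_gt0.
pose f c : R := \sum_i Num.min (c * w 0 i) m.
have f0 : f 0 = 0 by rewrite /f big1 // => i _; rewrite mul0r min_l // ltW.
(* This value exceeds every threshold m / w i, so all coordinates are capped at it. *)
pose b := \sum_i m / w 0 i.
have b0 : 0 <= b by rewrite sumr_ge0 // => i _; rewrite divr_ge0 // ltW.
have fb : 1 <= f b.
  have -> : f b = \sum_(i < n) m.
    apply: eq_bigr => i _; apply: min_r; rewrite -ler_pdivrMr //.
    by rewrite /b (bigD1 i) //= lerDl sumr_ge0 // => j _; rewrite divr_ge0 // ltW.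
  rewrite sumr_const card_ord -[m *+ n]mulr_natr mulrC ler_pdivlMr ?ltr0n ?subn_gt0 //.
  by rewrite mul1r ler_nat leq_subr.
have cf : continuous (f : R^o -> R^o).
  apply: continuous_big => [|i _ c]; first exact: add_continuous.
  apply: (@continuous_min _ R^o (fun c => c * w 0 i) (fun=> m)); last exact: cvg_cst.
  by apply: cvgMr_tmp; exact: cvg_id.
have [||c] := @IVT R f 0 b 1 b0; first exact: continuous_subspaceT.
  by rewrite f0 ge_min le_max ler01 fb orbT.
rewrite in_itv /= => /andP[c0 _] fc; exists c => //.
rewrite lt_neqAle c0 andbT; apply/eqP => ce; move: fc; rewrite -ce f0 => /eqP.
by rewrite eq_sym oner_eq0.
Qed.

(* The minimiser is [odiag U q] with [q i = min (c * w i) (1 / (n - k))]; it is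
   identified through the equality case of Klein's inequality. *)
Lemma capped_projection n k (U : 'M[R]_n) (w : 'rV[R]_n) (Wn : 'M[R]_n) :
  (k < n)%N -> U *m U^T = 1%:M -> (forall i, 0 < w 0 i) -> \sum_i w 0 i = 1 ->
  capped_set n k Wn ->
  (forall W, capped_set n k W -> relent Wn (odiag U w) <= relent W (odiag U w)) ->
  mx_pd Wn /\ forall Q, capped_set n k Q ->
    \tr (Q *m mxln (odiag U w)) <= \tr (Q *m mxln Wn).
Proof.
move=> kn UU w0 w1 cWn minWn.
have [c c0 cE] := capped_scaling kn w0; set m := (n - k)%:R^-1 in cE.
have m0 : 0 < m by rewrite invr_gt0 ltr0n subn_gt0.
pose q := \row_i Num.min (c * w 0 i) m.
have q0 i : 0 < q 0 i by rewrite mxE lt_min m0 mulr_gt0.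
have q1 : \sum_i q 0 i = 1 by rewrite -[RHS]cE; apply: eq_bigr => i _; rewrite mxE.
have cq : capped_set n k (odiag U q).
  by apply: capped_odiag => // i; rewrite ltW //= mxE ge_min lexx orbT.
(* First-order optimality of [q]: ln q - ln w - ln c is 0 on uncapped coordinates and negative on
   capped ones, where the diagonal of [Q] in the basis [U] is at most m = q i. The shift by ln c is
   harmless, since all traces are 1. *)
have opt Q : capped_set n k Q ->
  relent (odiag U q) (odiag U w) <=
  \tr (Q *m mxln (odiag U q)) - \tr (Q *m mxln (odiag U w)).
  move=> cQ; have [_ [Q0 [_ Q1]]] := cQ.
  rewrite /relent /mxln !mxfun_odiag // !mxtrace_mul_odiag -!sumrB.
  have sh (a : 'I_n -> R) : \sum_i a i = 1 ->
    \sum_i (a i * map_mx (@ln R) q 0 i - a i * map_mx (@ln R) w 0 i) =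
    \sum_i a i * (ln (q 0 i) - ln (w 0 i) - ln c) + ln c.
    move=> a1; rewrite -[X in _ + X]mul1r -a1 mulr_suml -big_split /=.
    by apply: eq_bigr => i _; rewrite !mxE; ring.
  rewrite !sh ?lerD2r; last 2 first.
  - by rewrite -mxtrace_form.
  - by rewrite -mxtrace_form // mxtrace_odiag.
  apply: ler_sum => i _; rewrite odiag_eigen // mxE.
  have [le|lt] := leP (c * w 0 i) m.
    by rewrite lnM ?posrE // (_ : _ - _ - _ = 0) ?mulr0 //; ring.
  apply: ler_wnM2r.
    have := lt; rewrite -ltr_ln ?posrE ?mulr_gt0 // lnM ?posrE //; lra.
  apply: le_trans (capped_form_le _ kn cQ) _.
  rewrite (_ : sqnorm _ = 1) ?mulr1 // -(orthogonal_col_sqr i UU).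
  by apply: eq_bigr => j _; rewrite mxE.
have [sWn [pWn [_ tWn]]] := cWn.
have sq : mx_sym (odiag U q) by exact: odiag_trmx.
have pq : mx_pd (odiag U q) by exact: odiag_pd.
have tq : \tr (odiag U q) = 1 by rewrite mxtrace_odiag.
(* Minimality of [Wn] together with [opt] at [Wn] gives [relent Wn (odiag U q) <= 0]. *)
have -> : Wn = odiag U q.
  apply: relent_le0_eq => //; first by rewrite tWn tq.
  have := opt _ cWn; have := minWn _ cq; rewrite /relent; lra.
split=> // Q cQ; rewrite -subr_ge0; apply: le_trans (opt _ cQ).
apply: relent_ge0 => //; first exact: mx_pd_psd.
- exact: odiag_trmx.
- exact: odiag_pd.
- by rewrite tq mxtrace_odiag.
Qed.

(** As ln V = ln W - eta x x^T - ln Z, testing against [V] itself identifies - ln Z with relent V W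
    + eta Tr(V x x^T), which [relent_tradeoff] bounds below; testing against [Q] then gives the
    claim. *)
Lemma entropic_update n (W Q : 'M[R]_n) (x : 'cV[R]_n) (eta : R) :
  mx_sym W -> mx_pd W -> \tr W = 1 -> sqnorm x <= 1 -> 0 <= eta ->
  let E := mxexp (mxln W - eta *: outer x) in
  let V := (\tr E)^-1 *: E in
  [/\ mx_pd V, \tr V = 1 & \tr Q = 1 ->
  \tr (Q *m mxln W) + eta / (1 + eta) * \tr (W *m outer x) - eta * \tr (Q *m outer x)
    <= \tr (Q *m mxln V)].
Proof.
move=> sW W0 W1 x1 e0; pose H := mxln W - eta *: outer x => E V.
have sH : H^T = H.
  rewrite /H [LHS]linearB /= [trmx (_ *: _)]linearZ /= /outer trmx_mul trmxK.
  by rewrite mxfun_trmx.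
have [G [h [GG HE]]] := symmetric_odiag sH.
have EE : E = odiag G (map_mx expR h) by rewrite /E -/H HE /mxexp mxfun_odiag.
have ZE : \tr E = \sum_i expR (h 0 i).
  by rewrite EE mxtrace_odiag //; apply: eq_bigr => i _; rewrite mxE.
have n0 : (0 < n)%N.
  case: n W W1 {sW W0 Q x x1 H E V sH G h GG HE EE ZE} => // W.
  by rewrite /mxtrace big_ord0 => /eqP; rewrite eq_sym oner_eq0.
have Z0 : 0 < \tr E.
  rewrite ZE (bigD1 (Ordinal n0)) //= ltr_pwDl ?expR_gt0 //.
  by apply: sumr_ge0 => i _; exact: expR_ge0.
set Z := \tr E in Z0 *.
have VE : V = odiag G (Z^-1 *: map_mx expR h) by rewrite odiagZ -EE.
have V0 : mx_pd V.
  by rewrite VE; apply: odiag_pd => // i; rewrite !mxE mulr_gt0 ?invr_gt0 ?expR_gt0.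
have V1 : \tr V = 1 by rewrite /V mxtraceZ -/Z mulVf // gt_eqF.
have lnV : mxln V = H - (ln Z)%:M.
  rewrite VE /mxln mxfun_odiag // -(odiag_const (ln Z) GG) HE.
  rewrite -[- odiag _ _]scaleN1r -odiagZ -odiagD; congr odiag; apply/rowP => i.
  rewrite !mxE lnM ?posrE ?invr_gt0 ?expR_gt0 // expRK lnV ?posrE //; ring.
have trln B : \tr B = 1 ->
  \tr (B *m mxln V) = \tr (B *m mxln W) - eta * \tr (B *m outer x) - ln Z.
  move=> B1; rewrite lnV /H !mulmxBr !linearB /= mul_mx_scalar mxtraceZ B1.
  by rewrite -scalemxAr mxtraceZ mulr1.
split=> // Q1.
have sV : mx_sym V by rewrite VE; exact: odiag_trmx.
have := @relent_tradeoff R n V W x eta sV (mx_pd_psd V0) sW W0 _ x1 e0.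
rewrite V1 W1 => /(_ erefl); rewrite /relent !trln //; lra.
Qed.

(** Mixed eigenvalues are at least (1 - alpha) v i, which gives the first bound, and at least alpha
    / n, which gives a bound independent of the past. The projection preserves both. *)
Lemma pca_step_progress n k (alpha eta : R) (x : 'cV[R]_n) (W V Wh Wn : 'M[R]_n) :
  (k < n)%N -> 0 < alpha < 1 -> 0 <= eta -> sqnorm x <= 1 ->
  capped_set n k W -> mx_pd W -> pca_step k alpha eta x W V Wh Wn ->
  mx_pd Wn /\ forall Q, capped_set n k Q ->
    \tr (Q *m mxln W) + eta / (1 + eta) * \tr (W *m outer x) - eta * \tr (Q *m outer x)
      + ln (1 - alpha) <= \tr (Q *m mxln Wn) /\
    ln (alpha / n%:R) <= \tr (Q *m mxln Wn).
Proof.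
move=> kn /andP[a0 a1] e0 x1 [sW [W0 [_ W1]]] pW.
move=> [VE [[U [v [UU [Vv WhE]]]] [cWn minWn]]].
have n0 : 0 < n%:R :> R by rewrite ltr0n (leq_ltn_trans _ kn).
have upd Q := entropic_update Q sW pW W1 x1 e0.
(* Positivity and trace of [V] do not involve [Q], so 0 is a placeholder. *)
have [V0 V1 _] := upd 0; rewrite -VE in V0 V1.
have v0 : forall i, 0 < v 0 i by apply: (pd_odiag UU); rewrite /odiag -Vv.
have v1 : \sum_i v 0 i = 1 by rewrite -(mxtrace_odiag v UU) /odiag -Vv.
pose w := \row_i (alpha / n%:R + (1 - alpha) * v 0 i).
have an0 : 0 < alpha / n%:R by rewrite divr_gt0.
have av i : 0 < (1 - alpha) * v 0 i by rewrite mulr_gt0 // subr_gt0.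
have w0 i : 0 < w 0 i by rewrite mxE addr_gt0.
have w1 : \sum_i w 0 i = 1.
  rewrite (eq_bigr (fun i => alpha / n%:R + (1 - alpha) * v 0 i)) => [|i _]; last by rewrite mxE.
  rewrite big_split /= sumr_const card_ord -mulr_sumr v1 -[_ *+ n]mulr_natr.
  by rewrite divfK ?gt_eqF // mulr1; ring.
have WhE' : Wh = odiag U w by [].
rewrite WhE' in minWn.
have [pWn prog] := capped_projection kn UU w0 w1 cWn minWn.
split=> // Q cQ; have [_ [Q0 [_ Q1]]] := cQ.
have [_ _ /(_ Q1)] := upd Q; rewrite -VE Vv -/(odiag U v) => updQ.
have := prog Q cQ; move: updQ; rewrite /mxln !(mxfun_odiag _ _ UU) => updQ progQ.
have tc a : \tr (Q *m odiag U (const_mx a)) = a.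
  by rewrite odiag_const // mul_mx_scalar mxtraceZ Q1 mulr1.
split; apply: le_trans progQ.
  apply: le_trans (lerD updQ (lexx _)) _.
  rewrite -[X in _ + X]tc -linearD -mulmxDr -odiagD; apply: mxtrace_psd_le => // i.
  rewrite !mxE addrC -lnM ?posrE ?subr_gt0 //.
  by rewrite ler_ln ?posrE ?addr_gt0 // lerDr ltW.
rewrite -[X in X <= _]tc; apply: mxtrace_psd_le => // i.
by rewrite !mxE ler_ln ?posrE ?addr_gt0 // lerDl ltW.
Qed.

Lemma capped_mxtrace_ln_le0 n k (Q W : 'M[R]_n) : capped_set n k Q -> capped_set n k W ->
  mx_pd W -> \tr (Q *m mxln W) <= 0.
Proof.
move=> [_ [Q0 [_ Q1]]] [+ [_ [_ +]]].
move=> /symmetric_odiag[U [q [UU ->]]]; rewrite mxtrace_odiag // => q1 /(pd_odiag UU) q0.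
rewrite /mxln mxfun_odiag //.
have -> : 0 = \tr (Q *m odiag U (const_mx 0)).
  by rewrite odiag_const // mul_mx_scalar scale0r linear0.
apply: mxtrace_psd_le => // i; rewrite !mxE ln_le0 // -q1 (bigD1 i) //= lerDl.
by apply: sumr_ge0 => j _; exact: ltW.
Qed.

End CappedProjection.

(** * Linearised losses, comparators, and the tuning of the rate *)

Section Regret.
Variable R : realType.
Implicit Types (n k : nat).

(** The complement of the played projection is linear in the sampled vector, so averaging rebuilds
    (n - k) W. *)
Lemma exp_lossE n k (W Dm : 'M[R]_n) s (x : 'cV[R]_n) : valid_sampling k W Dm s ->
  exp_loss k Dm s x = (n - k)%:R * \tr (W *m outer x).
Proof.
move=> [_ [-> _]].
rewrite linear_sum mulmx_sumr !mulmx_suml raddf_sum mulr_sumr.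
apply: eq_bigr => pr _; rewrite /played_proj opprB addrC subrK.
by rewrite -scalemxAl mxtraceZ !linearZ /= -!scalemxAl mxtraceZ mulrCA.
Qed.

(** For a full-rank factorisation U = A B, cancelling in A B A B = A B gives B A = 1, whose size is
    the rank. *)
Lemma mxtrace_idempotent n (U : 'M[R]_n) : U *m U = U -> \tr U = (\rank U)%:R.
Proof.
move=> UU; rewrite -[in LHS](mulmx_base U) mxtrace_mulC -[RHS]mxtrace1.
move: (mulmx_base U) (row_base_free U) (col_base_full U).
move: (col_base U) (row_base U) => A B AB fB fA; congr mxtrace.
apply: (row_full_inj fA); apply: (row_free_inj fB).
by rewrite mulmx1 !mulmxA -mulmxA AB UU.
Qed.

(** [1 - U] is a projection of trace n - k, with eigenvalues in [0, 1]. Its normalisation is the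
    capped matrix having the same loss as [U]. *)
Lemma rankk_proj_capped n k (U : 'M[R]_n) : (k < n)%N -> rankk_proj k U ->
  capped_set n k ((n - k)%:R^-1 *: (1%:M - U)).
Proof.
move=> kn [sU [UU rU]]; set P := 1%:M - U; set m := (n - k)%:R^-1.
have N0 : 0 < (n - k)%:R :> R by rewrite ltr0n subn_gt0.
have m0 : 0 <= m by rewrite invr_ge0 ltW.
have sP : P^T = P by rewrite /P [LHS]linearB /= trmx1 sU.
have PP : P *m P = P.
  by rewrite /P mulmxBl mul1mx mulmxBr mulmx1 UU subrr subr0.
have [G [d [GG PE]]] := symmetric_odiag sP.
have dd i : d 0 i * d 0 i = d 0 i.
  move: PP; rewrite PE odiagM // => /(congr1 (fun A => ((col i G)^T *m A *m col i G) 0 0)).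
  by rewrite !odiag_eigen // mxE.
have d01 i : 0 <= d 0 i <= 1.
  have := sqr_ge0 (d 0 i); have := sqr_ge0 (1 - d 0 i).
  have -> : (1 - d 0 i) ^+ 2 = 1 - 2 * d 0 i + d 0 i * d 0 i by ring.
  by rewrite expr2 dd; lra.
rewrite PE -odiagZ; apply: capped_odiag => // [i|].
  have /andP[d0 d1] := d01 i; rewrite mxE mulr_ge0 //=.
  by rewrite ler_piMr.
have -> : \sum_i (m *: d) 0 i = m * \tr P.
  by rewrite PE mxtrace_odiag // mulr_sumr; apply: eq_bigr => i _; rewrite mxE.
rewrite /P linearB /= mxtrace1 mxtrace_idempotent // rU -natrB ?(ltnW kn) //.
by rewrite mulVf // gt_eqF.
Qed.

Lemma ln1D_ge (y : R) : 0 < y -> y / (1 + y) <= ln (1 + y).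
Proof.
move=> y0; have y1 : 0 < 1 + y by lra.
rewrite -lerN2 -lnV ?posrE //.
rewrite [X in ln X](_ : _ = 1 + - (y / (1 + y))); last by field; rewrite gt_eqF.
by apply: le_ln1Dx; rewrite ltrN2 ltr_pdivrMr // mul1r ltrDr.
Qed.

(** With y = sqrt (2 D / L), y / (1 + y) <= eta <= y. Multiplying the hypothesis by (1 + eta) / eta
    leaves the excess eta X + D + D / eta, where eta X <= y L = sqrt (2 L D). *)
Lemma tuned_rate_bound (L D A X : R) : 0 < L -> 1 <= D -> 0 <= X <= L ->
  let eta := ln (1 + Num.sqrt (2 * D / L)) in
  eta / (1 + eta) * A <= eta * X + D ->
  A <= X + 2 * (Num.sqrt (2 * L * D) + D).
Proof.
move=> L0 D1 /andP[X0 XL] eta h.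
have D0 : 0 < D by lra.
have y0 : 0 < Num.sqrt (2 * D / L) by rewrite sqrtr_gt0 divr_gt0 // mulr_gt0.
have y2 : Num.sqrt (2 * D / L) ^+ 2 = 2 * D / L by rewrite sqr_sqrtr // ltW // divr_gt0 // mulr_gt0.
have SE : Num.sqrt (2 * L * D) = Num.sqrt (2 * D / L) * L.
  rewrite (_ : 2 * L * D = 2 * D / L * L ^+ 2); last by field; rewrite gt_eqF.
  rewrite sqrtrM; last by rewrite ltW // divr_gt0 // mulr_gt0.
  by rewrite sqrtr_sqr gtr0_norm.
rewrite {}SE; move: y0 y2 @eta h; move: (Num.sqrt _) => y y0 y2 eta h.
have eta_ge : y / (1 + y) <= eta by exact: ln1D_ge.
have eta_le : eta <= y by apply: le_ln1Dx; lra.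
have eta0 : 0 < eta by apply: lt_le_trans eta_ge; rewrite divr_gt0 // addr_gt0.
clearbody eta.
have DE : D = y * (y * L) / 2.
  rewrite (_ : y * (y * L) = y ^+ 2 * L); last ring.
  by rewrite y2; field; rewrite gt_eqF.
have yL0 : 0 < y * L by rewrite mulr_gt0.
(* Since D = y^2 L / 2, the right side equals D (1 + y) / y. *)
have Deta : D / eta <= y * L / 2 + D.
  rewrite ler_pdivrMr // -(ler_pM2r (_ : 0 < (1 + y)^-1)) ?invr_gt0 ?addr_gt0 //.
  have : (y * L / 2 + D) * (y / (1 + y)) <= (y * L / 2 + D) * eta.
    by rewrite ler_wpM2l // addr_ge0 ?ltW // divr_gt0.
  have -> : (y * L / 2 + D) * (y / (1 + y)) = D.
    by rewrite DE; field; rewrite gt_eqF // addr_gt0.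
  move=> h'; rewrite ler_pM2r ?invr_gt0 ?addr_gt0 //.
have AE : A <= (1 + eta) * X + D + D / eta.
  have e1 : 0 < (1 + eta) / eta by rewrite divr_gt0 // addr_gt0.
  have := h; rewrite -(ler_pM2l e1).
  have -> : (1 + eta) / eta * (eta / (1 + eta) * A) = A.
    by field; rewrite !gt_eqF // addr_gt0.
  have -> : (1 + eta) / eta * (eta * X + D) = (1 + eta) * X + D + D / eta.
    by field; rewrite gt_eqF.
  by [].
have : eta * X <= y * L by rewrite ler_pM // ltW.
move: AE Deta; rewrite mulrDl mul1r; move: (D / eta) (eta * X) => a b; lra.
Qed.

(** * Telescoping the potential over an interval *)

Section Run.
Variables (n k T : nat) (x : nat -> 'cV[R]_n) (W V Wh : nat -> 'M[R]_n) (alpha eta : R).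
Hypotheses (kn : (k < n)%N) (x1 : forall t, (1 <= t <= T)%N -> sqnorm (x t) <= 1)
  (a01 : 0 < alpha < 1) (eta0 : 0 <= eta)
  (W1c : capped_set n k (W 1%N)) (W1p : mx_pd (W 1%N))
  (step : forall t, (1 <= t < T)%N ->
    pca_step k alpha eta (x t) (W t) (V t.+1) (Wh t.+1) (W t.+1)).

Lemma iterates_capped t : (1 <= t <= T)%N -> capped_set n k (W t) /\ mx_pd (W t).
Proof.
elim: t => // -[_ _|t IH]; first by [].
move=> /andP[_ tT]; have [|c p] := IH; first by rewrite /= ltnW.
have st := step (t := t.+1) tT.
split; first by case: st => _ [_ [] ].
by have [] := pca_step_progress kn a01 eta0 (x1 (t := t.+1) (ltnW tT)) c p st.
Qed.

(** The potential [psi] telescopes from r + 1 to s: the mixing of round r bounds it below at the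
    start, whatever happened before, and it is never positive at the end. *)
Lemma interval_loss r s Q : (1 <= r)%N -> (r < s)%N -> (s <= T)%N -> capped_set n k Q ->
  eta / (1 + eta) * \sum_(r.+1 <= t < s) \tr (W t *m outer (x t))
  <= eta * \sum_(r.+1 <= t < s) \tr (Q *m outer (x t))
     - ln (alpha / n%:R) - T%:R * ln (1 - alpha).
Proof.
move=> r1 rs sT cQ; pose psi t := \tr (Q *m mxln (W t)).
have prog t : (1 <= t < T)%N -> eta / (1 + eta) * \tr (W t *m outer (x t))
    - eta * \tr (Q *m outer (x t)) + ln (1 - alpha) <= psi t.+1 - psi t.
  move=> /andP[t1 tT]; have tT' : (1 <= t <= T)%N by rewrite t1 ltnW.
  have [c p] := iterates_capped tT'.
  have [_ /(_ _ cQ)[+ _]] :=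
    pca_step_progress kn a01 eta0 (x1 tT') c p (step (introT andP (conj t1 tT))).
  rewrite /psi; lra.
have start : ln (alpha / n%:R) <= psi r.+1.
  have rT : (1 <= r <= T)%N by rewrite r1 (leq_trans (ltnW rs)).
  have [c p] := iterates_capped rT.
  have rT' : (1 <= r < T)%N by rewrite r1 (leq_trans rs).
  by have [_ /(_ _ cQ)[_]] := pca_step_progress kn a01 eta0 (x1 rT) c p (step rT').
have stop : psi s <= 0.
  have [|c p] := iterates_capped (t := s); first by rewrite sT (leq_trans r1) // ltnW.
  exact: capped_mxtrace_ln_le0 cQ c p.
have : \sum_(r.+1 <= t < s) (eta / (1 + eta) * \tr (W t *m outer (x t))
    - eta * \tr (Q *m outer (x t)) + ln (1 - alpha)) <= psi s - psi r.+1.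
  rewrite -telescope_sumr // !big_nat; apply: ler_sum => t /andP[rt ts].
  by apply: prog; rewrite (leq_trans _ rt) // (leq_trans ts).
rewrite big_split sumrB /= -!mulr_sumr sumr_const_nat.
(* The logarithm is nonpositive, so the number of rounds may be raised to [T]. *)
have : T%:R * ln (1 - alpha) <= ln (1 - alpha) *+ (s - r.+1).
  rewrite mulr_natl -lerN2 -!mulNrn; apply: ler_wpMn2l; last first.
    by rewrite (leq_trans (leq_subr _ _)).
  by rewrite oppr_ge0 ln_le0 // gerBl; case/andP: a01 => /ltW.
lra.
Qed.

End Run.

End Regret.

(** * Regret against rank-k projections on every interval *)

Theorem theorem4p3 :
  exists C : nat, forall (R : realType) (n k T : nat) (x : nat -> 'cV[R]_n) (L : R)
    (W V Wh Dm : nat -> 'M[R]_n) (smp : nat -> seq (R * 'rV[R]_n)),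
  (1 <= k)%N -> (k < n)%N -> (1 <= T)%N ->
  (forall t, (1 <= t <= T)%N -> sqnorm (x t) <= 1) ->
  0 < L ->
  (forall r s, (1 <= r)%N -> (r <= s)%N -> (s <= T)%N ->
     exists Q, capped_set n k Q /\
       \sum_(r <= t < s.+1) (n - k)%:R * \tr (Q *m outer (x t)) <= L) ->
  let alpha : R := ((T * (n - k) + 1)%N%:R)^-1 in
  let D : R := (n - k)%:R * ln (n%:R * (1 + (n - k)%:R * T%:R)) + 1 in
  let eta : R := ln (1 + Num.sqrt (2 * D / L)) in
  capped_set n k (W 1%N) -> mx_pd (W 1%N) ->
  (forall t, (1 <= t < T)%N ->
     pca_step k alpha eta (x t) (W t) (V t.+1) (Wh t.+1) (W t.+1)) ->
  (forall t, (1 <= t <= T)%N -> valid_sampling k (W t) (Dm t) (smp t)) ->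
  forall (r s : nat) (U : 'M[R]_n),
    (1 <= r)%N -> (r <= s)%N -> (s <= T)%N -> rankk_proj k U ->
    \sum_(r <= t < s.+1) exp_loss k (Dm t) (smp t) (x t)
      - \sum_(r <= t < s.+1) \tr ((1%:M - U) *m outer (x t))
    <= C%:R * (Num.sqrt (2 * L * D) + D).
Proof.
(* The inner rounds contribute 2 B, and the two end rounds at most 1 <= B each. *)
exists 4%N => R n k T x L W V Wh Dm smp _ kn T1 x1 L0 hL alpha D eta W1c W1p step samp.
move=> r s U r1 rs sT pU.
have N0 : 0 < (n - k)%:R :> R by rewrite ltr0n subn_gt0.
have T0 : 0 < T%:R :> R by rewrite ltr0n.
have n1 : 1 <= n%:R :> R by rewrite ler1n (leq_ltn_trans _ kn).
set N : R := (n - k)%:R in hL D eta step N0 *.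
have NT0 : 0 < T%:R * N by rewrite mulr_gt0.
have alphaE : alpha = (1 + N * T%:R)^-1.
  by rewrite /alpha natrD natrM -/N addrC mulrC.
have a01 : 0 < alpha < 1.
  have NT0' : 0 < N * T%:R by rewrite mulrC.
  by rewrite alphaE invr_gt0 invf_lt1 ?addr_gt0 // ltrDl.
have arg1 : 1 <= n%:R * (1 + N * T%:R).
  by rewrite mulr_ege1 // lerDl mulrC ltW.
have D1 : 1 <= D by rewrite /D lerDr mulr_ge0 ?ln_ge0 // ltW.
have eta0 : 0 <= eta by rewrite ln_ge0 // lerDl sqrtr_ge0.
have lnstart : ln (alpha / n%:R) = - ln (n%:R * (1 + N * T%:R)).
  rewrite -lnV ?posrE ?(lt_le_trans ltr01 arg1) //; congr ln.
  by rewrite alphaE invfM mulrC.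
(* This [alpha] makes 1 / (1 - alpha) = 1 + 1 / (T N), so all mixing costs add up to at most 1 / N;
   scaled by [N], they are the + 1 in [D]. *)
have lnmix : - (T%:R * ln (1 - alpha)) <= N^-1.
  have -> : 1 - alpha = (1 + (T%:R * N)^-1)^-1.
    by rewrite alphaE; field; rewrite !gt_eqF // ltr_wpDl // ltW.
  rewrite lnV ?posrE ?addr_gt0 ?invr_gt0 // mulrN opprK.
  rewrite -[N^-1](mulVKf (lt0r_neq0 T0)) ler_pM2l //.
  rewrite -invfM; apply: le_ln1Dx; apply: lt_trans (_ : 0 < _); first by rewrite ltrN10.
  by rewrite invr_gt0.
have iter t : (1 <= t <= T)%N -> capped_set n k (W t) /\ mx_pd (W t).
  exact: iterates_capped kn x1 a01 eta0 W1c W1p step t.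
pose loss t := N * \tr (W t *m outer (x t)).
have loss1 t : (1 <= t <= T)%N -> loss t <= 1.
  move=> tT; rewrite /loss mxtrace_outer -[X in _ <= X](mulfV (lt0r_neq0 N0)) ler_pM2l //.
  apply: le_trans (capped_form_le _ kn (iter t tT).1) _.
  by rewrite ler_piMr ?x1 // invr_ge0 ltW.
pose cost Q := \sum_(r <= t < s.+1) N * \tr (Q *m outer (x t)).
have cost_term Q t : capped_set n k Q -> 0 <= N * \tr (Q *m outer (x t)).
  by move=> [_ [Q0 _]]; rewrite mxtrace_outer mulr_ge0 // ltW.
have cost0 Q : capped_set n k Q -> 0 <= cost Q.
  by move=> cQ; apply: sumr_ge0 => t _; exact: cost_term.
set B := Num.sqrt (2 * L * D) + D.
have B1 : 1 <= B by rewrite ler_wpDl // sqrtr_ge0.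
have main Q : capped_set n k Q -> cost Q <= L ->
    \sum_(r <= t < s.+1) loss t <= cost Q + 4 * B.
  move=> cQ QL; have := cost0 Q cQ.
  have [rs'|srE] : (r < s)%N \/ r = s.
    by move: rs; rewrite leq_eqVlt => /orP[/eqP|]; [right|left].
  (* A one-round interval has no inner rounds; its loss is at most 1. *)
  2: { rewrite -srE big_nat1 => cQ0; have := loss1 r; rewrite r1 srE sT => /(_ isT).
       rewrite -srE; move: B1 cQ0; lra. }
  move=> cQ0; rewrite big_nat_recr //= big_ltn //.
  have := loss1 r; rewrite r1 (leq_trans rs) // => /(_ isT).
  have := loss1 s; rewrite sT (leq_trans r1) // => /(_ isT).
  set A := \sum_(r.+1 <= t < s) loss t.
  pose X := \sum_(r.+1 <= t < s) N * \tr (Q *m outer (x t)).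
  have X0 : 0 <= X by apply: sumr_ge0 => t _; exact: cost_term.
  have XQ : X <= cost Q.
    rewrite /cost big_nat_recr //= big_ltn // -/X.
    by have := cost_term Q r cQ; have := cost_term Q s cQ; lra.
  have : A <= X + 2 * B.
    apply: tuned_rate_bound => //; first by rewrite X0 (le_trans XQ).
    rewrite -/eta /A /X /loss -!mulr_sumr [X in X <= _]mulrCA [eta * (N * _)]mulrCA.
    have := interval_loss kn x1 a01 eta0 W1c W1p step r1 rs' sT cQ.
    rewrite lnstart opprK -(ler_pM2l N0) => /le_trans; apply.
    (* After scaling by [N], the starting bound matches the logarithmic part of [D]. *)
    rewrite /D -addrA mulrDr lerD2l mulrDr lerD2l.
    by rewrite -[X in _ <= X](mulfV (lt0r_neq0 N0)) ler_pM2l.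
  move: XQ B1; lra.
rewrite (_ : \sum_(r <= t < s.+1) exp_loss _ _ _ _ = \sum_(r <= t < s.+1) loss t); last first.
  apply: eq_big_nat => t /andP[rt ts]; apply: exp_lossE; apply: samp.
  by rewrite (leq_trans r1) // (leq_trans _ sT).
pose QU := N^-1 *: (1%:M - U).
have cQU : capped_set n k QU by exact: rankk_proj_capped.
rewrite (_ : \sum_(r <= t < s.+1) \tr _ = cost QU); last first.
  apply: eq_bigr => t _; rewrite /QU -scalemxAl mxtraceZ mulrA mulfV ?mul1r //.
  by rewrite gt_eqF.
rewrite lerBlDl.
(* The tuning requires a comparator of cost at most [L]; if [QU] exceeds it, the one from [hL] is
   cheaper, so its bound suffices. *)
have [/(main _ cQU)//|/ltW LU] := leP (cost QU) L.
have [Q [cQ QL]] := hL r s r1 rs sT.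
apply: le_trans (main Q cQ QL) _; rewrite lerD2r; exact: le_trans LU.
Qed.
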